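(* Let $\Lambda:\mathbb{R}\to[0,1]$ be a right continuous function that is either increasing with $\sup_x\Lambda(x)<1$, or decreasing with $\inf_x\Lambda(x)<1$. For $\alpha\in\mathbb{R}$ let $\Lambda^\alpha(x):=\Lambda(x+\alpha)$. Then, for every $P\in\mathcal{P}(\mathbb{R})$ and every $\alpha\in\mathbb{R}$, $$\Lambda V@R(T_\alpha P)=\Lambda^\alpha V@R(P)-\alpha .$$
   Context: $\mathcal{P}(\mathbb{R})$ is the set of Borel probability measures on $\mathbb{R}$, and $F_P(x)=P(-\infty,x]$. For $\alpha\in\mathbb{R}$, $T_\alpha P$ is the translated measure with $T_\alpha P(-\infty,x]=P(-\infty,x-\alpha]$ (the law of $X+\alpha$ if $X$ has law $P$). For $\Lambda:\mathbb{R}\to[0,1]$ and $m\in\mathbb{R}$ set $F_m(x):=\Lambda(x)\mathbf{1}_{(-\infty,m)}(x)+\mathbf{1}_{[m,+\infty)}(x)$ and define $\Lambda V@R(P):=-\sup\{m\in\mathbb{R}\mid F_P(x)\le F_m(x)\ \forall x\in\mathbb{R}\}\in\mathbb{R}\cup\{+\infty\}$, with $\sup\emptyset=-\infty$. $\Lambda^\alpha V@R$ denotes the same construction with $\Lambda$ replaced by $\Lambda^\alpha$. ''Increasing'' and ''decreasing'' are meant in the weak sense. *)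

(* Defs.v *)
From HB Require Import structures.
From mathcomp Require Import all_boot all_order all_algebra.
From mathcomp Require Import all_classical all_reals all_analysis.
From mathcomp Require Import measurable_realfun.

Set Implicit Arguments.
Unset Strict Implicit.
Unset Printing Implicit Defensive.

Import Order.TTheory GRing.Theory Num.Theory.
Import numFieldNormedType.Exports.

Local Open Scope classical_set_scope.
Local Open Scope ring_scope.

(* A Borel probability measure on the real line is an element of
   [probability (measurableTypeR R) R]. *)

Definition translation (R : realType) (a : R) :
  measurableTypeR R -> measurableTypeR R := fun x => (x : R) + a.

Lemma measurable_translation (R : realType) (a : R) :
  measurable_fun [set: measurableTypeR R] (translation a).
Proof.
exact: (measurable_funD (@measurable_id _ (measurableTypeR R) setT)
  (measurable_cst a)).
Qed.

HB.instance Definition _ (R : realType) (a : R) :=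
  isMeasurableFun.Build _ _ _ _ (translation a) (measurable_translation a).

(* The law of X + a when X has law P. *)
Definition translate (R : realType) (a : R)
    (P : probability (measurableTypeR R) R) :
  probability (measurableTypeR R) R := distribution P (translation a).

Definition distribution_function (R : realType)
    (P : probability (measurableTypeR R) R) (x : R) : \bar R :=
  P `]-oo, x]%classic.

Lemma distribution_function_translate (R : realType) (a : R)
    (P : probability (measurableTypeR R) R) (x : R) :
  distribution_function (translate a P) x = distribution_function P (x - a).
Proof.
rewrite /distribution_function /translate /distribution /= /pushforward.
congr (P _); apply/seteqP; split => y /=;
  by rewrite /translation /= !in_itv /= lerBrDr.
Qed.

Definition threshold (R : realType) (L : R -> R) (m x : R) : R :=
  L x * \1_(`]-oo, m[%classic) x + \1_(`[m, +oo[%classic) x.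

(* The supremum is taken in the extended reals, where the supremum of the empty
   set is -oo; the value is then +oo. *)
Definition LambdaVaR (R : realType) (L : R -> R)
    (P : probability (measurableTypeR R) R) : \bar R :=
  (- ereal_sup [set m%:E | m in
      [set m : R | forall x : R,
        distribution_function P x <= (threshold L m x)%:E]])%E.

Definition shift_argument (R : realType) (L : R -> R) (a : R) : R -> R :=
  fun x => L (x + a).

(* Main.v *)
Require Import Defs.
From mathcomp Require Import all_boot all_order all_algebra.
From mathcomp Require Import all_classical all_reals all_analysis.

Set Implicit Arguments.
Unset Strict Implicit.
Unset Printing Implicit Defensive.

Import Order.TTheory GRing.Theory Num.Theory.
Import numFieldNormedType.Exports.

Local Open Scope classical_set_scope.
Local Open Scope ring_scope.

(** Translating [P] by [a] moves the graph of its distribution function right by [a]. The same move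
    carries the threshold of [shift_argument L a] at level [m] to that of [L] at level [m + a]
    ([threshold_shift_argument]). So the levels admissible for [translate a P] and [L] are those for
    [P] and [shift_argument L a], moved by [a]; their supremum moves by [a] ([ereal_sup_translate]),
    and the outer minus sign turns this into [- a]. *)

Lemma threshold_shift_argument (R : realType) (L : R -> R) (a m x : R) :
  threshold (shift_argument L a) m x = threshold L (m + a) (x + a).
Proof.
by rewrite /threshold /shift_argument !indicE !mem_setE !in_itv /= !andbT
  ltrD2r lerD2r.
Qed.

(** Adding a finite number is an order automorphism of the extended reals, so empty and unbounded
    [A] need no separate case. *)
Lemma ereal_sup_translate (R : realType) (A : set R) (a : R) :
  ereal_sup [set m%:E | m in [set m | A (m - a)]] =
  (ereal_sup [set m%:E | m in A] + a%:E)%E.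
Proof.
apply/eqP; rewrite eq_le; apply/andP; split.
  apply: ge_ereal_sup => _ [m Am <-].
  rewrite -leeBlDr// -EFinB.
  by apply: ereal_sup_ubound; exists (m - a).
rewrite -leeBrDr//; apply: ge_ereal_sup => _ [m Am <-].
rewrite leeBrDr// -EFinD.
by apply: ereal_sup_ubound; exists (m + a) => //=; rewrite addrK.
Qed.

Theorem mainTheorem7 (R : realType) (L : R -> R)
    (L01 : forall x : R, 0 <= L x <= 1)
    (Lrc : right_continuous L)
    (Lmono : (nondecreasing_fun L /\ sup (range L) < 1) \/
             (nonincreasing_fun L /\ inf (range L) < 1))
    (P : probability (measurableTypeR R) R) (a : R) :
  LambdaVaR L (translate a P) = (LambdaVaR (shift_argument L a) P - a%:E)%E.
Proof.
have acceptE : [set m : R | forall x : R,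
    (distribution_function (translate a P) x <= (threshold L m x)%:E)%E] =
  [set m | [set k : R | forall x : R,
    (distribution_function P x <=
      (threshold (shift_argument L a) k x)%:E)%E] (m - a)].
  apply/seteqP; split => m accept x.
    (* Admissibility is tested at every real point, so the test point may be shifted along with the
       graphs. *)
    have := accept (x + a).
    by rewrite distribution_function_translate addrK
      threshold_shift_argument subrK.
  have := accept (x - a).
  by rewrite distribution_function_translate threshold_shift_argument !subrK.
(* The minus sign distributes even over an infinite supremum because [a] is finite. *)
by rewrite /LambdaVaR acceptE ereal_sup_translate fin_num_oppeD.
Qed.
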